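(* Each of Lemmon's logics E2, E3, E4, E5 is strongly complete with respect to the following class of Kripke frames with impossible worlds $(W,S,N)$: (E2) the frames satisfying $\forall x(Nx\to Sxx)$; (E3) the frames satisfying $\forall x(Nx\to Sxx)$ and $\forall x\forall y\forall z(Nx\wedge Ny\wedge Sxy\wedge Syz\to Sxz)$; (E4) the frames satisfying $\forall x(Nx\to Sxx)$, $\forall x\forall y\forall z(Nx\wedge Ny\wedge Sxy\wedge Syz\to Sxz)$ and $\forall x\forall y(Nx\wedge Sxy\to Ny)$; (E5) the frames satisfying $\forall x(Nx\to Sxx)$, $\forall x\forall y\forall z(Nx\wedge Ny\wedge Sxy\wedge Sxz\to Syz)$ and $\forall x\,Nx$.
   Context: Formulas are those of classical propositional modal logic with $\Box$, with $\Diamond$ abbreviating $\neg\Box\neg$. Axioms: (1) $\Box(p\to q)\to\Box(\Box p\to\Box q)$; (1') $\Box(p\to q)\to(\Box p\to\Box q)$; (2) $\Box p\to p$; (4) $\Box p\to\Box\Box p$; (5) $\neg\Box p\to\Box\neg\Box p$. PC consists of all propositional tautologies, uniform substitution for propositional variables and modus ponens. Rule (Eb): from $\vdash\alpha\to\beta$ infer $\vdash\Box\alpha\to\Box\beta$. The logics are: E2 = PC + (Eb) + (1') + (2); E3 = PC + (Eb) + (1) + (2); E4 = E2 + (4); E5 = E2 + (5). A Kripke frame with impossible worlds is a triple $(W,S,N)$ with $W\ne\varnothing$, $N\subseteq W$ and $S\subseteq N\times W$. A model adds a valuation $V:\mathsf{Prop}\to\mathcal{P}(W)$; atomic and Boolean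 clauses of satisfaction are as usual, $w\Vdash\Box\phi$ iff $w\in N$ and $v\Vdash\phi$ for all $v$ with $wSv$, and $w\Vdash\Diamond\phi$ iff $w\notin N$ or $v\Vdash\phi$ for some $v$ with $wSv$. A logic $\Lambda$ is strongly complete with respect to a class $\mathcal{C}$ of frames if for every set $\Gamma\cup\{\varphi\}$ of formulas: whenever $\varphi$ holds at every point, of every model based on a frame in $\mathcal{C}$, at which all members of $\Gamma$ hold, then there are $\gamma_1,\dots,\gamma_n\in\Gamma$ ($n\ge0$) such that $(\gamma_1\wedge\dots\wedge\gamma_n)\to\varphi$ is a theorem of $\Lambda$. *)

(* Defs.v *)
From Stdlib Require Import List Classical.

Set Implicit Arguments.
Unset Strict Implicit.

Inductive form (Var : Type) : Type :=
| Atom (p : Var)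
| Bot
| Neg (a : form Var)
| And (a b : form Var)
| Or (a b : form Var)
| Imp (a b : form Var)
| Box (a : form Var).

Arguments Bot {Var}.

Definition Top {Var : Type} : form Var := Neg Bot.

Definition Dia (Var : Type) (a : form Var) : form Var := Neg (Box (Neg a)).

(* The empty conjunction is [Top]. *)
Definition conj_list (Var : Type) (l : list (form Var)) : form Var :=
  fold_right (@And Var) Top l.

Fixpoint subst (Var : Type) (s : Var -> form Var) (a : form Var) : form Var :=
  match a with
  | Atom p => s p
  | Bot => Bot
  | Neg b => Neg (subst s b)
  | And b c => And (subst s b) (subst s c)
  | Or b c => Or (subst s b) (subst s c)
  | Imp b c => Imp (subst s b) (subst s c)
  | Box b => Box (subst s b)
  end.

(* [truth v a] is [None] when [a] contains a box, i.e. is not a formula of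
   propositional logic. *)
Fixpoint truth (Var : Type) (v : Var -> bool) (a : form Var) : option bool :=
  let op2 (f : bool -> bool -> bool) (x y : option bool) :=
    match x, y with Some b, Some c => Some (f b c) | _, _ => None end in
  match a with
  | Atom p => Some (v p)
  | Bot => Some false
  | Neg b => option_map negb (truth v b)
  | And b c => op2 andb (truth v b) (truth v c)
  | Or b c => op2 orb (truth v b) (truth v c)
  | Imp b c => op2 implb (truth v b) (truth v c)
  | Box _ => None
  end.

(* Only box-free formulas qualify; tautological instances with boxes are
   obtained in [provable] by uniform substitution. *)
Definition tautology (Var : Type) (a : form Var) : Prop :=
  forall v : Var -> bool, truth v a = Some true.

(* PC + (Eb) + the axioms [Ax]. *)
Inductive provable (Var : Type) (Ax : form Var -> Prop) : form Var -> Prop :=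
| prov_taut a : tautology a -> provable Ax a
| prov_ax a : Ax a -> provable Ax a
| prov_subst s a : provable Ax a -> provable Ax (subst s a)
| prov_mp a b : provable Ax (Imp a b) -> provable Ax a -> provable Ax b
| prov_Eb a b : provable Ax (Imp a b) -> provable Ax (Imp (Box a) (Box b)).

(* The axioms are single formulas in propositional variables [p], [q], not
   schemes.  Letting [p] and [q] range over all variables only adds
   substitution instances. *)
Inductive axiom1 (Var : Type) : form Var -> Prop :=
| axiom1_intro p q :
    axiom1 (Imp (Box (Imp (Atom p) (Atom q)))
                (Box (Imp (Box (Atom p)) (Box (Atom q))))).

Inductive axiom1' (Var : Type) : form Var -> Prop :=
| axiom1'_intro p q :
    axiom1' (Imp (Box (Imp (Atom p) (Atom q)))
                 (Imp (Box (Atom p)) (Box (Atom q)))).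

Inductive axiom2 (Var : Type) : form Var -> Prop :=
| axiom2_intro p : axiom2 (Imp (Box (Atom p)) (Atom p)).

Inductive axiom4 (Var : Type) : form Var -> Prop :=
| axiom4_intro p : axiom4 (Imp (Box (Atom p)) (Box (Box (Atom p)))).

Inductive axiom5 (Var : Type) : form Var -> Prop :=
| axiom5_intro p :
    axiom5 (Imp (Neg (Box (Atom p))) (Box (Neg (Box (Atom p))))).

Definition E2 (Var : Type) : form Var -> Prop :=
  provable (fun a => axiom1' a \/ axiom2 a).

Definition E3 (Var : Type) : form Var -> Prop :=
  provable (fun a => axiom1 a \/ axiom2 a).

Definition E4 (Var : Type) : form Var -> Prop :=
  provable (fun a => axiom1' a \/ axiom2 a \/ axiom4 a).

Definition E5 (Var : Type) : form Var -> Prop :=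
  provable (fun a => axiom1' a \/ axiom2 a \/ axiom5 a).

Record frame : Type := Frame {
  world : Type;
  world_inh : inhabited world;
  normal : world -> Prop;
  acc : world -> world -> Prop;
  acc_normal : forall x y, acc x y -> normal x
}.

Arguments normal {_} _.
Arguments acc {_} _ _.

Fixpoint sat (Var : Type) (F : frame) (V : Var -> world F -> Prop) (w : world F)
    (a : form Var) : Prop :=
  match a with
  | Atom p => V p w
  | Bot => False
  | Neg b => ~ sat V w b
  | And b c => sat V w b /\ sat V w c
  | Or b c => sat V w b \/ sat V w c
  | Imp b c => sat V w b -> sat V w c
  | Box b => normal w /\ forall v, acc w v -> sat V v b
  end.

Lemma sat_Dia (Var : Type) (F : frame) (V : Var -> world F -> Prop) (w : world F)
    (a : form Var) :
  sat V w (Dia a) <-> ~ normal w \/ exists v, acc w v /\ sat V v a.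
Proof.
split.
- intros H. destruct (classic (normal w)) as [Hw | Hw]; [right | now left].
  apply NNPP. intros Hn. apply H. split; [exact Hw |].
  intros v Hv Ha. apply Hn. now exists v.
- intros [Hw | [v [Hv Ha]]] [Hw' Hbox].
  + contradiction.
  + exact (Hbox v Hv Ha).
Qed.

Definition strongly_complete (Var : Type) (L : form Var -> Prop)
    (C : frame -> Prop) : Prop :=
  forall (Gamma : form Var -> Prop) (phi : form Var),
    (forall F : frame, C F -> forall (V : Var -> world F -> Prop) (w : world F),
        (forall g, Gamma g -> sat V w g) -> sat V w phi) ->
    exists l : list (form Var),
      (forall g, In g l -> Gamma g) /\ L (Imp (conj_list l) phi).

Definition E2_frame (F : frame) : Prop :=
  forall x : world F, normal x -> acc x x.

Definition E3_frame (F : frame) : Prop :=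
  (forall x : world F, normal x -> acc x x) /\
  (forall x y z : world F, normal x /\ normal y /\ acc x y /\ acc y z -> acc x z).

Definition E4_frame (F : frame) : Prop :=
  (forall x : world F, normal x -> acc x x) /\
  (forall x y z : world F, normal x /\ normal y /\ acc x y /\ acc y z -> acc x z) /\
  (forall x y : world F, normal x /\ acc x y -> normal y).

Definition E5_frame (F : frame) : Prop :=
  (forall x : world F, normal x -> acc x x) /\
  (forall x y z : world F, normal x /\ normal y /\ acc x y /\ acc x z -> acc y z) /\
  (forall x : world F, normal x).

Definition infinite (T : Type) : Prop :=
  exists f : nat -> T, forall m n, f m = f n -> m = n.

(* Main.v *)
(** Completeness by canonical models.  The worlds are the maximal consistent
    sets; a world is normal when it contains some boxed formula, and [x] sees
    [y] when [x] is normal and [y] contains [a] whenever [x] contains [Box a].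
    The rule (Eb) together with (1') replaces necessitation at normal worlds: if
    [Box b] belongs to [x] and [a] is a theorem, then so is [b -> a], and
    [Box a] belongs to [x].  The axioms of each logic then give the required
    frame conditions. *)

From Stdlib Require Import List Classical.
From mathcomp Require boolp classical_sets.
Require Import Defs.

Set Implicit Arguments.
Unset Strict Implicit.

(** * Derivations from hypotheses *)

(** Modus ponens is the only rule here. (Eb) and substitution act inside [L] alone, which is what
    lets the deduction theorem hold. *)
Inductive derives (Var : Type) (L : form Var -> Prop) (G : form Var -> Prop) :
  form Var -> Prop :=
| der_hyp a : G a -> derives L G a
| der_thm a : L a -> derives L G a
| der_mp a b : derives L G (Imp a b) -> derives L G a -> derives L G b.

Definition add (Var : Type) (G : form Var -> Prop) (a : form Var) : form Var -> Prop :=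
  fun b => G b \/ b = a.

Definition consistent (Var : Type) (L G : form Var -> Prop) : Prop :=
  ~ derives L G Bot.

Definition mcs (Var : Type) (L w : form Var -> Prop) : Prop :=
  consistent L w /\ forall a, w a \/ w (Neg a).

Lemma derives_mono (Var : Type) (L G H : form Var -> Prop) (a : form Var) :
  (forall b, G b -> H b) -> derives L G a -> derives L H a.
Proof.
intros GH D; induction D as [a Ga | a La | a b _ IH1 _ IH2].
- now apply der_hyp, GH.
- now apply der_thm.
- exact (der_mp IH1 IH2).
Qed.

Lemma derives_finite (Var : Type) (L G : form Var -> Prop) (a : form Var) :
  derives L G a ->
  exists l, (forall g, In g l -> G g) /\ derives L (fun g => In g l) a.
Proof.
intros D; induction D as [a Ga | a La | a b _ [l [lG Dl]] _ [m [mG Dm]]].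
- exists (a :: nil); split.
  + now intros g [<- | []].
  + now apply der_hyp; left.
- exists nil; split; [easy | now apply der_thm].
- exists (l ++ m); split.
  + intros g Hg; apply in_app_or in Hg; destruct Hg; auto.
  + apply der_mp with a;
      [apply derives_mono with (2 := Dl) | apply derives_mono with (2 := Dm)];
      intros; apply in_or_app; auto.
Qed.

(** A derivation uses finitely many hypotheses, and the larger of two members of the chain serves
    both premises of modus ponens. The left disjunct covers derivations that use no member, so [F]
    may be empty. *)
Lemma derives_chain (Var : Type) (L G : form Var -> Prop)
    (F : (form Var -> Prop) -> Prop) (a : form Var) :
  (forall X Y, F X -> F Y -> (forall b, X b -> Y b) \/ (forall b, Y b -> X b)) ->
  derives L (fun b => G b \/ exists X, F X /\ X b) a ->
  derives L G a \/ exists X, F X /\ derives L (fun b => G b \/ X b) a.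
Proof.
intros tot D; induction D as [a [Ga | [X [FX Xa]]] | a La | a b _ IH1 _ IH2].
- now left; apply der_hyp.
- right; exists X; split; [exact FX | now apply der_hyp; right].
- now left; apply der_thm.
- destruct IH1 as [D1 | [X [FX D1]]]; destruct IH2 as [D2 | [Y [FY D2]]].
  + left; exact (der_mp D1 D2).
  + right; exists Y; split; [exact FY |].
    refine (der_mp _ D2); apply derives_mono with (2 := D1); auto.
  + right; exists X; split; [exact FX |].
    refine (der_mp D1 _); apply derives_mono with (2 := D2); auto.
  + right; destruct (tot X Y FX FY) as [XY | YX].
    * exists Y; split; [exact FY |].
      refine (der_mp _ D2); apply derives_mono with (2 := D1); intuition.
    * exists X; split; [exact FX |].
      refine (der_mp D1 _); apply derives_mono with (2 := D2); intuition.
Qed.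

(** * Substitution instances of tautologies and axioms *)

Lemma assignment (Var : Type) (f : nat -> Var) (g : nat -> form Var) :
  (forall m n, f m = f n -> m = n) ->
  exists s : Var -> form Var, forall n, s (f n) = g n.
Proof.
intros finj.
exists (fun x => match boolp.pselect (exists n, f n = x) with
                 | left h => g (proj1_sig (boolp.cid h))
                 | right _ => Bot
                 end).
intros n; destruct (boolp.pselect _) as [h | h].
- destruct (boolp.cid h) as [m Hm]; simpl; now rewrite (finj _ _ Hm).
- now destruct h; exists n.
Qed.

(** Three distinct variables can be sent to any three formulas, which is enough to turn each axiom
    and tautology used below into a scheme. *)
Lemma assignment3 (Var : Type) (Var_inf : infinite Var) :
  exists p q r : Var, forall a b c : form Var,
    exists s : Var -> form Var, s p = a /\ s q = b /\ s r = c.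
Proof.
destruct Var_inf as [f finj].
exists (f 0), (f 1), (f 2); intros a b c.
destruct (assignment (fun n => match n with 0 => a | 1 => b | _ => c end) finj) as [s Hs].
exists s; now rewrite !Hs.
Qed.

Section Schemes.

Variables (Var : Type) (Var_inf : infinite Var) (Ax : form Var -> Prop).

(** The truth table is checked on variables and the result is then substituted, since [truth] is
    [None] on the boxes that [a], [b], [c] may contain. *)
Ltac tauto_scheme a b c t :=
  let p := fresh in let q := fresh in let r := fresh in
  let s := fresh in let H := fresh in let T := fresh in
  let Ea := fresh in let Eb := fresh in let Ec := fresh in
  destruct (assignment3 Var_inf) as [p [q [r H]]];
  destruct (H a b c) as [s [Ea [Eb Ec]]];
  let u := eval cbv beta in (t (Atom p) (Atom q) (Atom r)) in
  assert (T : tautology u)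
    by (intros v; simpl; destruct (v p), (v q), (v r); reflexivity);
  apply (@prov_taut Var Ax), (prov_subst s) in T; simpl in T;
  now rewrite ?Ea, ?Eb, ?Ec in T.

Lemma scheme_K a b : provable Ax (Imp a (Imp b a)).
Proof. tauto_scheme a b a (fun p q r : form Var => Imp p (Imp q p)). Qed.

Lemma scheme_S a b c :
  provable Ax (Imp (Imp a (Imp b c)) (Imp (Imp a b) (Imp a c))).
Proof.
tauto_scheme a b c
  (fun p q r : form Var => Imp (Imp p (Imp q r)) (Imp (Imp p q) (Imp p r))).
Qed.

Lemma scheme_I a : provable Ax (Imp a a).
Proof. tauto_scheme a a a (fun p q r : form Var => Imp p p). Qed.

Lemma scheme_neg_elim a : provable Ax (Imp (Neg a) (Imp a Bot)).
Proof. tauto_scheme a a a (fun p q r : form Var => Imp (Neg p) (Imp p Bot)). Qed.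

Lemma scheme_neg_intro a : provable Ax (Imp (Imp a Bot) (Neg a)).
Proof. tauto_scheme a a a (fun p q r : form Var => Imp (Imp p Bot) (Neg p)). Qed.

Lemma scheme_raa a : provable Ax (Imp (Imp (Neg a) Bot) a).
Proof. tauto_scheme a a a (fun p q r : form Var => Imp (Imp (Neg p) Bot) p). Qed.

Lemma scheme_efq a b : provable Ax (Imp (Neg a) (Imp a b)).
Proof. tauto_scheme a b a (fun p q r : form Var => Imp (Neg p) (Imp p q)). Qed.

Lemma scheme_and_intro a b : provable Ax (Imp a (Imp b (And a b))).
Proof. tauto_scheme a b a (fun p q r : form Var => Imp p (Imp q (And p q))). Qed.

Lemma scheme_and_l a b : provable Ax (Imp (And a b) a).
Proof. tauto_scheme a b a (fun p q r : form Var => Imp (And p q) p). Qed.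

Lemma scheme_and_r a b : provable Ax (Imp (And a b) b).
Proof. tauto_scheme a b a (fun p q r : form Var => Imp (And p q) q). Qed.

Lemma scheme_or_l a b : provable Ax (Imp a (Or a b)).
Proof. tauto_scheme a b a (fun p q r : form Var => Imp p (Or p q)). Qed.

Lemma scheme_or_r a b : provable Ax (Imp b (Or a b)).
Proof. tauto_scheme a b a (fun p q r : form Var => Imp q (Or p q)). Qed.

Lemma scheme_or_elim a b : provable Ax (Imp (Or a b) (Imp (Neg a) b)).
Proof. tauto_scheme a b a (fun p q r : form Var => Imp (Or p q) (Imp (Neg p) q)). Qed.

Lemma scheme_1 a b :
  (forall x, axiom1 x -> Ax x) ->
  provable Ax (Imp (Box (Imp a b)) (Box (Imp (Box a) (Box b)))).
Proof.
intros H; destruct (assignment3 Var_inf) as [p [q [r Hs]]].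
destruct (Hs a b a) as [s [<- [<- _]]].
exact (prov_subst s (prov_ax (H _ (axiom1_intro p q)))).
Qed.

Lemma scheme_1' a b :
  (forall x, axiom1' x -> Ax x) ->
  provable Ax (Imp (Box (Imp a b)) (Imp (Box a) (Box b))).
Proof.
intros H; destruct (assignment3 Var_inf) as [p [q [r Hs]]].
destruct (Hs a b a) as [s [<- [<- _]]].
exact (prov_subst s (prov_ax (H _ (axiom1'_intro p q)))).
Qed.

Lemma scheme_2 a :
  (forall x, axiom2 x -> Ax x) -> provable Ax (Imp (Box a) a).
Proof.
intros H; destruct (assignment3 Var_inf) as [p [q [r Hs]]].
destruct (Hs a a a) as [s [<- _]].
exact (prov_subst s (prov_ax (H _ (axiom2_intro p)))).
Qed.

Lemma scheme_4 a :
  (forall x, axiom4 x -> Ax x) -> provable Ax (Imp (Box a) (Box (Box a))).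
Proof.
intros H; destruct (assignment3 Var_inf) as [p [q [r Hs]]].
destruct (Hs a a a) as [s [<- _]].
exact (prov_subst s (prov_ax (H _ (axiom4_intro p)))).
Qed.

Lemma scheme_5 a :
  (forall x, axiom5 x -> Ax x) ->
  provable Ax (Imp (Neg (Box a)) (Box (Neg (Box a)))).
Proof.
intros H; destruct (assignment3 Var_inf) as [p [q [r Hs]]].
destruct (Hs a a a) as [s [<- _]].
exact (prov_subst s (prov_ax (H _ (axiom5_intro p)))).
Qed.

End Schemes.

(** * The deduction theorem and maximal consistent sets *)

Section Canonical.

Variables (Var : Type) (Var_inf : infinite Var) (Ax : form Var -> Prop).

Let L : form Var -> Prop := provable Ax.

Lemma deduction G a b : derives L (add G a) b -> derives L G (Imp a b).
Proof.
intros D; induction D as [b [Gb | ->] | b Lb | b c _ IH1 _ IH2].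
- exact (der_mp (der_thm _ (scheme_K Var_inf Ax b a)) (der_hyp _ Gb)).
- exact (der_thm _ (scheme_I Var_inf Ax a)).
- exact (der_mp (der_thm _ (scheme_K Var_inf Ax b a)) (der_thm _ Lb)).
- exact (der_mp (der_mp (der_thm _ (scheme_S Var_inf Ax a b c)) IH1) IH2).
Qed.

Lemma provable_imp_trans a b c : L (Imp a b) -> L (Imp b c) -> L (Imp a c).
Proof.
intros Hab Hbc.
exact (prov_mp (prov_mp (scheme_S Var_inf Ax a b c)
                        (prov_mp (scheme_K Var_inf Ax _ a) Hbc)) Hab).
Qed.

Lemma conj_list_elim l g : In g l -> L (Imp (conj_list l) g).
Proof.
induction l as [| a l IH]; [easy | intros [<- | Hg]].
- exact (scheme_and_l Var_inf Ax a (conj_list l)).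
- exact (provable_imp_trans (scheme_and_r Var_inf Ax a (conj_list l)) (IH Hg)).
Qed.

Lemma derives_conj_list l a : derives L (fun g => In g l) a -> L (Imp (conj_list l) a).
Proof.
intros D; induction D as [a Ha | a La | a b _ IH1 _ IH2].
- now apply conj_list_elim.
- exact (prov_mp (scheme_K Var_inf Ax a _) La).
- exact (prov_mp (prov_mp (scheme_S Var_inf Ax _ a b) IH1) IH2).
Qed.

Lemma lindenbaum G :
  consistent L G -> exists w, mcs L w /\ forall a, G a -> w a.
Proof.
intros cG.
(* [G] is kept out of the sets that Zorn's lemma compares, since the union of
   the empty chain is empty. *)
destruct (@classical_sets.Zorn_bigcup _
            (fun X : form Var -> Prop => consistent L (fun b => G b \/ X b)))
  as [A [cA maxA]].
- intros F FP tot D.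
  destruct (@derives_chain Var L G F Bot) as [D' | [X [FX D']]].
  + intros X Y FX FY; exact (tot X Y FX FY).
  + apply derives_mono with (2 := D).
    intros b [Gb | [X FX Xb]]; [now left | right; now exists X].
  + exact (cG D').
  + exact (FP X FX D').
- exists (fun b => G b \/ A b); split; [split; [exact cA |] | auto].
  (* Maximality of [A] puts into it every formula consistent with [G] and [A]. *)
  assert (mem : forall a, consistent L (add (fun b => G b \/ A b) a) -> A a).
  { intros a ca; apply NNPP; intros nAa.
    apply (maxA (add A a)).
    - split; [intros b Ab; now left | intros AA; apply nAa, AA; now right].
    - intros D; apply ca; apply derives_mono with (2 := D); unfold add; tauto. }
  intros a.
  destruct (classic (consistent L (add (fun b => G b \/ A b) a))) as [ca | ia].
  + left; right; now apply mem.
  (* If neither [a] nor [Neg a] could be added consistently, the set itself would derive [Bot]. *)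
  + right; right; apply mem; intros D.
    apply NNPP in ia; apply cA.
    exact (der_mp (deduction D)
             (der_mp (der_thm _ (scheme_neg_intro Var_inf Ax a)) (deduction ia))).
Qed.

Section World.

Variables (w : form Var -> Prop) (Hw : mcs L w).

Lemma mcs_derives a : derives L w a -> w a.
Proof.
intros D; destruct Hw as [cw ew]; destruct (ew a) as [wa | wna]; [exact wa |].
destruct cw.
exact (der_mp (der_mp (der_thm _ (scheme_neg_elim Var_inf Ax a)) (der_hyp _ wna)) D).
Qed.

Lemma mcs_imp a b : L (Imp a b) -> w a -> w b.
Proof.
intros H wa; apply mcs_derives; exact (der_mp (der_thm _ H) (der_hyp _ wa)).
Qed.

Lemma mcs_imp2 a b c : L (Imp a (Imp b c)) -> w a -> w b -> w c.
Proof.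
intros H wa wb; apply mcs_derives.
exact (der_mp (der_mp (der_thm _ H) (der_hyp _ wa)) (der_hyp _ wb)).
Qed.

Lemma mcs_Bot : ~ w Bot.
Proof. intros H; destruct Hw as [cw _]; exact (cw (der_hyp _ H)). Qed.

Lemma mcs_Neg a : w (Neg a) <-> ~ w a.
Proof.
split.
- intros wna wa; exact (mcs_Bot (mcs_imp2 (scheme_neg_elim Var_inf Ax a) wna wa)).
- intros nwa; destruct Hw as [_ ew]; now destruct (ew a).
Qed.

Lemma mcs_And a b : w (And a b) <-> w a /\ w b.
Proof.
split.
- intros H; split.
  + exact (mcs_imp (scheme_and_l Var_inf Ax a b) H).
  + exact (mcs_imp (scheme_and_r Var_inf Ax a b) H).
- intros [wa wb]; exact (mcs_imp2 (scheme_and_intro Var_inf Ax a b) wa wb).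
Qed.

Lemma mcs_Or a b : w (Or a b) <-> w a \/ w b.
Proof.
split.
- intros H; destruct (classic (w a)) as [wa | nwa]; [now left | right].
  exact (mcs_imp2 (scheme_or_elim Var_inf Ax a b) H (proj2 (mcs_Neg a) nwa)).
- intros [wa | wb].
  + exact (mcs_imp (scheme_or_l Var_inf Ax a b) wa).
  + exact (mcs_imp (scheme_or_r Var_inf Ax a b) wb).
Qed.

Lemma mcs_Imp a b : w (Imp a b) <-> (w a -> w b).
Proof.
split.
- intros H wa; apply mcs_derives; exact (der_mp (der_hyp _ H) (der_hyp _ wa)).
- intros H; destruct (classic (w a)) as [wa | nwa].
  + exact (mcs_imp (scheme_K Var_inf Ax b a) (H wa)).
  + exact (mcs_imp (scheme_efq Var_inf Ax a b) (proj2 (mcs_Neg a) nwa)).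
Qed.

(** Induction on the derivation: a theorem [a] is boxed by (Eb) applied to [Imp b a], with [Box b]
    in [w], and modus ponens is handled by [reg]. *)
Lemma mcs_unbox a :
  (forall b c, L (Imp (Box (Imp b c)) (Imp (Box b) (Box c)))) ->
  (exists b, w (Box b)) -> derives L (fun b => w (Box b)) a -> w (Box a).
Proof.
intros reg [b wb] D; induction D as [a Ha | a La | a c _ IH1 _ IH2].
- exact Ha.
- exact (mcs_imp (prov_Eb (prov_mp (scheme_K Var_inf Ax a b) La)) wb).
- exact (mcs_imp2 (reg a c) IH1 IH2).
Qed.

End World.

(** * The canonical frame and its truth lemma *)

Definition can_world : Type := {w : form Var -> Prop | mcs L w}.

Definition can_normal (x : can_world) : Prop := exists a, proj1_sig x (Box a).

(** At a world that is not normal the second conjunct is vacuous; the first keeps such a world from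
    seeing anything. *)
Definition can_acc (x y : can_world) : Prop :=
  can_normal x /\ forall a, proj1_sig x (Box a) -> proj1_sig y a.

Definition canonical (inh : inhabited can_world) : frame :=
  @Frame can_world inh can_normal can_acc (fun x y H => proj1 H).

Lemma can_acc_refl :
  (forall a, L (Imp (Box a) a)) -> forall x, can_normal x -> can_acc x x.
Proof.
intros T x Nx; split; [exact Nx |].
intros a; exact (mcs_imp (proj2_sig x) (T a)).
Qed.

Hypothesis reg : forall a b, L (Imp (Box (Imp a b)) (Imp (Box a) (Box b))).

Lemma truth_lemma (inh : inhabited can_world) (a : form Var) (x : can_world) :
  @sat Var (canonical inh) (fun p y => proj1_sig y (Atom p)) x a <-> proj1_sig x a.
Proof.
revert x; induction a as [p | | a IH | a IHa b IHb | a IHa b IHb | a IHa b IHb | a IH];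
  intros x; pose proof (proj2_sig x) as Hx; simpl.
- reflexivity.
- pose proof (mcs_Bot Hx); tauto.
- rewrite IH, (mcs_Neg Hx); reflexivity.
- rewrite IHa, IHb, (mcs_And Hx); reflexivity.
- rewrite IHa, IHb, (mcs_Or Hx); reflexivity.
- rewrite IHa, IHb, (mcs_Imp Hx); reflexivity.
- split.
  + intros [Nx Hbox]; apply (mcs_unbox Hx reg Nx); apply NNPP; intros nD.
    (* If the unboxed formulas of [x] do not derive [a], they extend to a world that [x] sees and
       that contains [Neg a]. *)
    destruct (@lindenbaum (add (fun b => proj1_sig x (Box b)) (Neg a)))
      as [y [Hy xy]].
    * intros D; apply nD.
      exact (der_mp (der_thm _ (scheme_raa Var_inf Ax a)) (deduction D)).
    * assert (ya : y a).
      { apply (IH (exist _ y Hy)), Hbox; split; [exact Nx |].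
        intros b xb; apply xy; now left. }
      apply (proj1 (mcs_Neg Hy a)); [apply xy; now right | exact ya].
  + intros H; split; [now exists a |].
    intros y [_ xy]; now apply IH, xy.
Qed.

(** If [G] does not derive [phi], some canonical world contains [G] and [Neg phi]. That world is
    also the inhabitant of the frame, whence the quantifier over [inh]. *)
Lemma canonical_completeness (C : frame -> Prop) :
  (forall inh, C (canonical inh)) -> strongly_complete L C.
Proof.
intros HC G phi Hphi.
destruct (classic (derives L G phi)) as [D | nD].
- destruct (derives_finite D) as [l [lG Dl]].
  exists l; split; [exact lG | now apply derives_conj_list].
- exfalso.
  destruct (@lindenbaum (add G (Neg phi))) as [w [Hw Gw]].
  + intros D; apply nD.
    exact (der_mp (der_thm _ (scheme_raa Var_inf Ax phi)) (deduction D)).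
  + pose (x := exist _ w Hw : can_world).
    apply (proj1 (mcs_Neg Hw phi)); [apply Gw; now right |].
    apply (truth_lemma (inhabits x) phi x).
    apply (Hphi (canonical (inhabits x)) (HC _)).
    intros g Gg; apply (truth_lemma (inhabits x) g x), Gw; now left.
Qed.

End Canonical.

(** * Frame conditions of the four canonical frames *)

Theorem theorem8p3 (Var : Type) (Var_inf : infinite Var) :
  strongly_complete (@E2 Var) E2_frame /\
  strongly_complete (@E3 Var) E3_frame /\
  strongly_complete (@E4 Var) E4_frame /\
  strongly_complete (@E5 Var) E5_frame.
Proof.
repeat split.
- apply canonical_completeness; [exact Var_inf | |].
  + intros a b; apply scheme_1'; auto.
  + intros inh; refine (can_acc_refl Var_inf _); intros a; apply scheme_2; auto.
- assert (T : forall a, @E3 Var (Imp (Box a) a)) by (intros a; apply scheme_2; auto).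
  assert (K : forall a b, @E3 Var (Imp (Box (Imp a b)) (Box (Imp (Box a) (Box b)))))
    by (intros a b; apply scheme_1; auto).
  apply canonical_completeness; [exact Var_inf | |].
  (* (1') follows from (1) by removing the outer box of its consequent with (2). *)
  + intros a b; exact (provable_imp_trans Var_inf (K a b) (T _)).
  + intros inh; split; [exact (can_acc_refl Var_inf T) |].
    intros x y z [Nx [[b yb] [[_ xy] [_ yz]]]]; split; [exact Nx |].
    (* [Box a] gives [Box (b -> a)], which axiom (1) turns into
       [Box (Box b -> Box a)]; normality of [y] supplies the [Box b]. *)
    intros a xa; apply yz.
    refine (proj1 (mcs_Imp Var_inf (proj2_sig y) (Box b) (Box a)) _ yb); apply xy.
    apply (mcs_imp Var_inf (proj2_sig x) (K b a)).
    exact (mcs_imp Var_inf (proj2_sig x) (prov_Eb (scheme_K Var_inf _ a b)) xa).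
- assert (H4 : forall a, @E4 Var (Imp (Box a) (Box (Box a))))
    by (intros a; apply scheme_4; auto).
  apply canonical_completeness; [exact Var_inf | |].
  + intros a b; apply scheme_1'; auto.
  + intros inh; split; [| split].
    * refine (can_acc_refl Var_inf _); intros a; apply scheme_2; auto.
    * intros x y z [Nx [_ [[_ xy] [_ yz]]]]; split; [exact Nx |].
      intros a xa; apply yz, xy; exact (mcs_imp Var_inf (proj2_sig x) (H4 a) xa).
    (* By (4), [Box (Box a)] is in [x], so the formula that makes [x] normal also makes [y]
       normal. *)
    * intros x y [[a xa] [_ xy]]; exists a; apply xy.
      exact (mcs_imp Var_inf (proj2_sig x) (H4 a) xa).
- assert (H5 : forall a, @E5 Var (Imp (Neg (Box a)) (Box (Neg (Box a)))))
    by (intros a; apply scheme_5; auto).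
  apply canonical_completeness; [exact Var_inf | |].
  + intros a b; apply scheme_1'; auto.
  + intros inh; split; [| split].
    * refine (can_acc_refl Var_inf _); intros a; apply scheme_2; auto.
    * intros x y z [_ [Ny [[_ xy] [_ xz]]]]; split; [exact Ny |].
      (* If [Box a] were missing from [x], (5) would put [Box (Neg (Box a))] into [x], hence
         [Neg (Box a)] into [y], against [ya]. *)
      intros a ya; apply xz, NNPP; intros nxa.
      apply (proj2 (mcs_Neg Var_inf (proj2_sig x) (Box a))) in nxa.
      apply (mcs_imp Var_inf (proj2_sig x) (H5 a)) in nxa.
      exact (proj1 (mcs_Neg Var_inf (proj2_sig y) (Box a)) (xy _ nxa) ya).
    * intros x; destruct (proj2_sig x) as [_ ex].
      (* Either [Box Bot] is in [x], or (5) boxes its negation; both ways [x] contains a boxed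
         formula. *)
      destruct (ex (Box Bot)) as [H | H]; [now exists Bot |].
      exists (Neg (Box Bot)); exact (mcs_imp Var_inf (proj2_sig x) (H5 Bot) H).
Qed.
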